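(* For any integer $k\geq 1$, every strongly $k$-connected tournament $T$ on $n$ vertices contains a strongly $k$-connected spanning subgraph $D$ with $|E(D)|\leq (5k-2)n + \binom{5k}{2}$.
   Context: A tournament is an orientation of a complete simple graph. A digraph $D$ is strongly connected if for any two vertices $u,v$ there is a directed path from $u$ to $v$. A digraph $D$ is strongly $k$-connected if $|V(D)| \geq k+1$ and for every set $S \subseteq V(D)$ with $|S| \leq k-1$, the digraph $D - S$ is strongly connected. $E(D)$ is the arc set of $D$. *)

(* Defs.v *)
From mathcomp Require Import all_boot.
Set Implicit Arguments. Unset Strict Implicit. Unset Printing Implicit Defensive.

(* A digraph on a finite vertex type V is given by its arc relation D : rel V.
   Digraphs here are simple: loops are excluded where relevant. *)

Definition is_tournament (V : finType) (T : rel V) : Prop :=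
  (forall v, ~~ T v v) /\
  (forall u v, u != v -> (T u v (+) T v u)).

Definition spanning_subgraph (V : finType) (D T : rel V) : Prop :=
  forall u v, D u v -> T u v.

Definition induced (V : finType) (D : rel V) (U : {set V}) : rel V :=
  [rel x y | [&& x \in U, y \in U & D x y]].

Definition strongly_connected_on (V : finType) (D : rel V) (U : {set V}) : Prop :=
  forall u v, u \in U -> v \in U -> connect (induced D U) u v.

Definition strongly_k_connected (V : finType) (D : rel V) (k : nat) : Prop :=
  k.+1 <= #|V| /\
  forall S : {set V}, #|S| <= k.-1 -> strongly_connected_on D (~: S).

Definition arcs (V : finType) (D : rel V) : {set V * V} :=
  [set p | D p.1 p.2].

(* Main.v *)
Require Import Defs.
From mathcomp Require Import all_boot.
From mathcomp Require Import zify.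

(* A minimal set of arcs preserving, for every deletion of fewer than k vertices,
   reachability of all vertices from a fixed set W with at least k elements has
   at most k arcs into each vertex, by uncrossing tight cuts. So kn arcs suffice
   for every vertex to be reached from W, and kn more for every vertex to reach a
   set U. It remains to link U to W robustly at bounded cost. Keep all arcs
   inside a set A of 5k vertices, and let U and W consist of the vertices of out-
   and indegree at least 2k in A. If deleting some S leaves u in U unable to
   reach w in W inside A, then the vertices of A outside S not reached from u
   dominate those reached from u; both classes have at least k elements, and they
   take the place of U and W. *)

Set Implicit Arguments. Unset Strict Implicit. Unset Printing Implicit Defensive.

(** * Mixed cuts, uncrossing and sparse rooted arc sets *)

Definition digraph_of (V : finType) (E : {set V * V}) : rel V :=
  [rel x y | (x, y) \in E].

(* A mixed cut: vertices outside X and Y count on a par with arcs from X to Y. *)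
Definition cut_weight (V : finType) (E : {set V * V}) (X Y : {set V}) : nat :=
  #|E :&: setX X Y| + #|~: (X :|: Y)|.

(** [X] is the source side and [Y] the side to be cut off from the roots [A]; vertices in neither
    act as deleted ones. *)
Definition rooted_pair (V : finType) (A X Y : {set V}) : bool :=
  [&& [disjoint X & Y], [disjoint A & Y] & Y != set0].

Definition rooted_cuts (V : finType) (k : nat) (A : {set V})
    (E : {set V * V}) : bool :=
  [forall X : {set V}, forall Y : {set V},
     rooted_pair A X Y ==> (k <= cut_weight E X Y)].

Lemma rooted_cutsP (V : finType) (k : nat) (A : {set V}) (E : {set V * V}) :
  reflect (forall X Y, rooted_pair A X Y -> k <= cut_weight E X Y)
          (rooted_cuts k A E).
Proof.
apply: (iffP forallP) => [h X Y|h X]; last by apply/forallP => Y; apply/implyP/h.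
by move/forallP: (h X) => /(_ Y) /implyP.
Qed.

(** For arcs and for vertices separately, the union and the intersection of the two sets counted on
    the left lie in those of the two counted on the right. *)
Lemma cut_weight_submod (V : finType) (E : {set V * V})
    (X Y X' Y' : {set V}) :
  cut_weight E (X :|: X') (Y :&: Y') + cut_weight E (X :&: X') (Y :|: Y')
  <= cut_weight E X Y + cut_weight E X' Y'.
Proof.
rewrite /cut_weight addnACA [leqRHS]addnACA; apply: leq_add;
  rewrite -cardsUI -[leqRHS]cardsUI; apply: leq_add; apply: subset_leq_card.
1,2: by apply/subsetP => -[x y]; rewrite !inE /=; do !case: (_ \in _).
all: by apply/subsetP => x; rewrite !inE; do !case: (_ \in _).
Qed.

Lemma cut_weightD1 (V : finType) (E : {set V * V}) (x v : V) (X Y : {set V}) :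
  cut_weight E X Y =
    [&& (x, v) \in E, x \in X & v \in Y] + cut_weight (E :\ (x, v)) X Y.
Proof. by rewrite /cut_weight (cardsD1 (x, v)) setIDAC !inE addnA. Qed.

(** Removing one arc lowers a weight by at most one, and only if the arc crosses the pair; a pair
    violated afterwards was crossed by it and tight. *)
Lemma rooted_cuts_critical (V : finType) (k : nat) (A : {set V})
    (E : {set V * V}) (x v : V) :
  rooted_cuts k A E -> ~~ rooted_cuts k A (E :\ (x, v)) ->
  exists X Y : {set V},
    [/\ rooted_pair A X Y, x \in X, v \in Y & cut_weight E X Y <= k].
Proof.
move=> /rooted_cutsP hE.
rewrite negb_forall => /existsP[X]; rewrite negb_forall => /existsP[Y].
rewrite negb_imply -ltnNge => /andP[hXY lt].
have := hE X Y hXY; rewrite (cut_weightD1 E x v).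
case: and3P => [[_ xX vY] _|_ /=]; last by rewrite leqNgt lt.
exists X, Y; split=> //; rewrite (cut_weightD1 E x v).
by apply: leq_trans lt; rewrite -add1n leq_add2r leq_b1.
Qed.

(* Uncrossing: the tight pair (X, Y) with v in Y and X maximal has every
   in-neighbour of v in X. *)
Lemma minimal_rooted_indegree (V : finType) (k : nat) (A : {set V})
    (E : {set V * V}) (v : V) :
  rooted_cuts k A E -> (forall e, e \in E -> ~~ rooted_cuts k A (E :\ e)) ->
  #|[set x | (x, v) \in E]| <= k.
Proof.
move=> hE minE.
have crit x (xvE : (x, v) \in E) := rooted_cuts_critical hE (minE _ xvE).
pose tight (p : {set V} * {set V}) :=
  [&& rooted_pair A p.1 p.2, v \in p.2 & cut_weight E p.1 p.2 <= k].
have [->|[x0]] := set_0Vmem [set x | (x, v) \in E]; first by rewrite cards0.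
rewrite inE => /crit[X0 [Y0 [r0 _ v0 t0]]].
have tight0 : tight (X0, Y0) by apply/and3P.
have [X [Y [/and3P[/= r vY t] maxX]]] : exists X Y : {set V}, tight (X, Y) /\
    forall X' Y', tight (X', Y') -> #|X'| <= #|X|.
  case: (arg_maxnP (fun p : {set V} * {set V} => #|p.1|) tight0) => -[X Y] tXY maxX.
  by exists X, Y; split=> // X' Y' /maxX.
(* Every arc into [v] then crosses from [X] to [Y], so the tight weight bounds the indegree. *)
suff sub : [set x | (x, v) \in E] \subset X.
  have inj : injective (fun x : V => (x, v)) by move=> ? ? [].
  apply: leq_trans t; apply: leq_trans (leq_addr _ _).
  rewrite -(card_imset _ inj).
  apply/subset_leq_card/subsetP => _ /imsetP[x xv ->].
  by have := subsetP sub x xv; move: xv; rewrite !inE /= => -> ->.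
apply/subsetP => x; rewrite inE => /crit[X' [Y' [r' xX' vY' t']]].
case/and3P: (r) => d dA nz; case/and3P: (r') => d' dA' nz'.
have rI : rooted_pair A (X :&: X') (Y :|: Y').
  apply/and3P; split; last by apply/set0Pn; exists v; rewrite inE vY.
  - by rewrite -setI_eq0 setIUr setU_eq0 !setI_eq0 (disjointWl (subsetIl _ _) d)
               (disjointWl (subsetIr _ _) d').
  - by rewrite -setI_eq0 setIUr setU_eq0 !setI_eq0 dA.
have rU : rooted_pair A (X :|: X') (Y :&: Y').
  apply/and3P; split; last by apply/set0Pn; exists v; rewrite inE vY.
  - by rewrite -setI_eq0 setIUl setU_eq0 !setI_eq0 (disjointWr (subsetIl _ _) d)
               (disjointWr (subsetIr _ _) d').
  - by apply: disjointWr dA; apply: subsetIl.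
have tU : tight (X :|: X', Y :&: Y').
  apply/and3P; split=> //=; first by rewrite inE vY.
  (* The other uncrossed pair weighs at least [k], so submodularity leaves at most [k] for this
     one. *)
  rewrite -(leq_add2r (cut_weight E (X :&: X') (Y :|: Y'))).
  apply: leq_trans (cut_weight_submod _ _ _ _ _) (leq_trans (leq_add t t') _).
  by rewrite leq_add2l (rooted_cutsP _ _ _ hE).
have hle := maxX _ _ tU.
have /eqP -> : X == X :|: X' by rewrite eqEcard subsetUl.
by rewrite inE xX' orbT.
Qed.

Lemma card_arcs_indegree (V : finType) (E : {set V * V}) :
  #|E| = \sum_v #|[set x | (x, v) \in E]|.
Proof.
under eq_bigr do rewrite -sum1_card.
rewrite -sum1_card (eq_bigl (fun p : V * V => true && ((p.1, p.2) \in E)));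
  last by case.
rewrite -(pair_big_dep xpredT (fun x y => (x, y) \in E) (fun _ _ => 1)) /=.
rewrite (exchange_big_dep xpredT) //=; apply: eq_bigr => v _.
by apply: eq_bigl => x; rewrite inE.
Qed.

(** Take an inclusion-minimal subset of [E] and sum its indegrees. *)
Lemma sparse_rooted_subgraph (V : finType) (k : nat) (A : {set V})
    (E : {set V * V}) :
  rooted_cuts k A E ->
  exists F : {set V * V}, [/\ F \subset E, rooted_cuts k A F & #|F| <= k * #|V|].
Proof.
case/minset_exists=> F /minsetP[hF minF] sFE; exists F; split=> //.
rewrite card_arcs_indegree mulnC -sum_nat_const; apply: leq_sum => v _.
apply: minimal_rooted_indegree hF _ => e eF; apply/negP => /minF.
by move/(_ (subD1set _ _))/setP/(_ e); rewrite !inE eqxx eF.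
Qed.

(** * From cuts to reachability and back *)

(** A light mixed cut would give a small vertex separator: replace each crossing arc by its tail. *)
Lemma rooted_cuts_strong (V : finType) (k : nat) (A : {set V}) (R : rel V) :
  0 < k -> k <= #|A| -> strongly_k_connected R k -> rooted_cuts k A (arcs R).
Proof.
move=> k0 kA [_ strong]; apply/rooted_cutsP => X Y /and3P[dXY dAY /set0Pn[y yY]].
rewrite leqNgt; apply/negP => few.
pose B := arcs R :&: setX X Y.
pose S := ~: (X :|: Y) :|: [set p.1 | p in B].
have SV : #|S| < k.
  apply: leq_ltn_trans few; rewrite (leq_trans (leq_card_setU _ _)) // addnC.
  by rewrite leq_add2r leq_imset_card.
have yS : y \in ~: S.
  rewrite !inE yY orbT /=; apply/imsetP => -[[a b]]; rewrite !inE /= => /and3P[_ aX _] ya.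
  by rewrite -ya in aX; rewrite (disjointFr dXY aX) in yY.
(* Fewer than [k] vertices are deleted, so a root survives; lying neither in [Y] nor in [S], it is
   in [X]. *)
have [a aA aS] : exists2 a, a \in A & a \notin S.
  apply/subsetPn; apply/negP => /subset_leq_card; lia.
have aX : a \in X.
  have := disjointFr dAY aA; move: aS; rewrite !inE negb_or negbK.
  by case/andP => /orP[]// ->.
have Sk : #|S| <= k.-1 by lia.
have := strong S Sk a y; rewrite inE aS yS => /(_ isT isT) /connectP[p hp yp].
(* A path avoiding [S] cannot leave [X], since the tails of all arcs from [X] to [Y] are in [S]. *)
suff : last a p \in X by rewrite -yp => /(disjointFr dXY); rewrite yY.
elim: p a aX {aA aS yp} hp => //= b p IH a aX /andP[/and3P[aS bS ab]]; apply: IH.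
rewrite !inE negb_or negbK in bS; case/andP: bS => /orP[]// bY _.
move: aS; rewrite !inE negb_or => /andP[_ /imsetP[]]; exists (a, b) => //.
by rewrite !inE /= ab aX.
Qed.

(** If [v] were unreachable, the surviving unreached vertices would form a [Y] that no arc enters
    from the reached ones, a cut of weight at most [#|S|]. *)
Lemma rooted_cuts_reach (V : finType) (k : nat) (A : {set V})
    (E : {set V * V}) (S : {set V}) (v : V) :
  rooted_cuts k A E -> #|S| < k -> v \notin S ->
  exists2 a, a \in A :\: S & connect (induced (digraph_of E) (~: S)) a v.
Proof.
move=> /rooted_cutsP hE Sk vS.
pose e := induced (digraph_of E) (~: S).
pose Y := [set y in ~: S | ~~ [exists a in A :\: S, connect e a y]].
case: (boolP (v \in Y)) => [vY|]; last first.
  by rewrite !inE vS negbK => /exists_inP[a aAS av]; exists a.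
have dXY : [disjoint ~: S :\: Y & Y] by rewrite disjoints_subset setDE subsetIr.
have rXY : rooted_pair A (~: S :\: Y) Y.
  apply/and3P; split=> //; last by apply/set0Pn; exists v.
  rewrite disjoints_subset; apply/subsetP => a aA; rewrite !inE negb_and !negbK.
case: (boolP (a \in S)) => //= aS; apply/existsP; exists a.
  by rewrite !inE aS aA /= connect0.
have E0 : E :&: setX (~: S :\: Y) Y = set0.
  apply/setP => -[x y]; rewrite !inE; apply/negP => /= /and3P[xy /andP[]].
  rewrite negb_and negbK => /orP[->//|]; rewrite negbK.
  case/exists_inP => a aAS ax xS /andP[yS /negP[]]; apply/exists_inP; exists a => //.
  by apply: connect_trans ax _; apply: connect1; rewrite /e /induced /= !inE xS yS.
have := hE _ _ rXY; rewrite /cut_weight E0 cards0 leqNgt (leq_trans _ Sk) // ltnS.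
apply/subset_leq_card/subsetP => z; rewrite !inE.
by case: (z \in S) => //=; rewrite !andbT orNb.
Qed.

Lemma strong_rooted_certificate (V : finType) (k : nat) (A : {set V})
    (R : rel V) :
  0 < k -> k <= #|A| -> strongly_k_connected R k ->
  exists F : {set V * V}, [/\ F \subset arcs R, #|F| <= k * #|V| &
    forall (S : {set V}) v, #|S| < k -> v \notin S ->
    exists2 a, a \in A :\: S & connect (induced (digraph_of F) (~: S)) a v].
Proof.
move=> k0 kA sR.
have [F [sF hF cF]] := sparse_rooted_subgraph (rooted_cuts_strong k0 kA sR).
by exists F; split=> // S v; apply: rooted_cuts_reach hF.
Qed.

(** * Reversal of arcs *)

Lemma induced_converse (V : finType) (R R' : rel V) (U : {set V}) :
  (forall x y, R' x y = R y x) ->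
  forall x y, connect (induced R' U) x y = connect (induced R U) y x.
Proof.
move=> h x y; rewrite -[RHS](connect_rev (induced R U)).
by apply: eq_connect => a b; rewrite /induced /= h andbCA.
Qed.

Lemma strongly_k_connected_converse (V : finType) (k : nat) (R : rel V) :
  strongly_k_connected R k -> strongly_k_connected [rel x y | R y x] k.
Proof.
move=> [c s]; split=> // S Sk u v uS vS.
by rewrite (induced_converse (R := R)) //; apply: s.
Qed.

Lemma is_tournament_converse (V : finType) (T : rel V) :
  is_tournament T -> is_tournament [rel x y | T y x].
Proof. by move=> [i t]; split=> // u v uv; rewrite /= addbC t. Qed.

Lemma strong_corooted_certificate (V : finType) (k : nat) (A : {set V})
    (R : rel V) :
  0 < k -> k <= #|A| -> strongly_k_connected R k ->
  exists F : {set V * V}, [/\ F \subset arcs R, #|F| <= k * #|V| &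
    forall (S : {set V}) v, #|S| < k -> v \notin S ->
    exists2 a, a \in A :\: S & connect (induced (digraph_of F) (~: S)) v a].
Proof.
move=> k0 kA /strongly_k_connected_converse sR.
have [F [sF cF hF]] := strong_rooted_certificate k0 kA sR.
exists [set p | (p.2, p.1) \in F]; split.
- by apply/subsetP => -[x y]; rewrite inE => /(subsetP sF); rewrite !inE.
- apply: leq_trans cF; rewrite -(card_imset _ (can_inj (@swap_pairK V V))).
  by apply/subset_leq_card/subsetP => _ /imsetP[[x y] h ->]; rewrite !inE in h *.
- move=> S v Sk vS; have [a aA av] := hF S v Sk vS; exists a => //.
  by rewrite (induced_converse (R := digraph_of F)) // => x y; rewrite /digraph_of /= inE.
Qed.

(** * Degree counting in tournaments *)

(** Added to its transpose, the sum counts each ordered pair of distinct vertices of [A] once. *)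
Lemma tournament_degree_sum (V : finType) (T : rel V) (A : {set V}) :
  is_tournament T ->
  (\sum_(x in A) #|[set y in A | T x y]|).*2 = #|A| * #|A|.-1.
Proof.
move=> [irr tot].
have E x : #|[set y in A | T x y]| = \sum_(y in A) T x y.
  by rewrite -sum1_card big_mkcond [RHS]big_mkcond; apply: eq_bigr => y _;
     rewrite inE; case: (y \in A) => //=; case: (T x y).
under eq_bigr do rewrite E.
rewrite -addnn [X in _ + X]exchange_big -big_split -sum_nat_const /=.
apply: eq_bigr => x xA; rewrite -big_split /= (cardsD1 x) xA /= -sum1_card.
rewrite (bigD1 x) //= (negbTE (irr x)) add0n; apply: eq_big => y.
  by rewrite !inE andbC.
by case/andP=> _ yx; have := tot x y; rewrite eq_sym yx => /(_ isT);
  case: (T x y); case: (T y x).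
Qed.

Lemma card_arcs_in_tournament (V : finType) (T : rel V) (A : {set V}) :
  is_tournament T -> #|arcs T :&: setX A A| = 'C(#|A|, 2).
Proof.
move=> hT; rewrite bin2 -(tournament_degree_sum A hT) doubleK.
under [RHS]eq_bigr do rewrite -sum1_card.
rewrite pair_big_dep -sum1_card; apply: eq_bigl => -[x y].
by rewrite !inE /= andbC andbA.
Qed.

(** Otherwise more than [4 * k] vertices have outdegree below [2 * k], yet the average outdegree in
    the tournament they span is at least [2 * k]. *)
Lemma many_high_outdegree (V : finType) (T : rel V) (k : nat) (A : {set V}) :
  0 < k -> is_tournament T -> 5 * k <= #|A| ->
  k <= #|[set x in A | 2 * k <= #|[set y in A | T x y]|]|.
Proof.
move=> k0 hT cA; set U := [set x in A | _]; rewrite leqNgt; apply/negP => cU.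
have := cardsID U A; rewrite (setIidPr _); last first.
  by apply/subsetP => z; rewrite inE => /andP[].
set B := A :\: U => cB.
have := tournament_degree_sum B hT.
have : \sum_(x in B) #|[set y in B | T x y]| <= \sum_(x in B) (2 * k).-1.
  apply: leq_sum => x xB.
  have : #|[set y in B | T x y]| <= #|[set y in A | T x y]|.
    apply/subset_leq_card/subsetP => y; rewrite !inE => /andP[/andP[_ ->] ->] //.
  move: xB; rewrite !inE negb_and -ltnNge => /andP[/orP[/negbTE->//|]]; lia.
rewrite sum_nat_const; have : 4 * k < #|B| by lia.
move: #|B| (\sum_(x in B) _) => b s; nia.
Qed.

(** * Robust linkage inside a bounded set *)

Lemma robust_pair (V : finType) (T : rel V) (k : nat) (A : {set V}) :
  0 < k -> is_tournament T -> 5 * k <= #|A| ->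
  exists U W : {set V}, [/\ k <= #|U|, k <= #|W| &
    forall (S : {set V}) u w, #|S| < k -> u \in U :\: S -> w \in W :\: S ->
    connect (induced (digraph_of (arcs T :&: setX A A)) (~: S)) u w].
Proof.
move=> k0 hT cA.
pose U := [set x in A | 2 * k <= #|[set y in A | T x y]|].
pose W := [set x in A | 2 * k <= #|[set y in A | T y x]|].
pose e S := induced (digraph_of (arcs T :&: setX A A)) (~: S).
have [/forallP good|] := boolP [forall S : {set V}, (#|S| < k) ==>
    [forall u in U :\: S, forall w in W :\: S, connect (e S) u w]].
  exists U, W; split.
  - exact: many_high_outdegree.
  - exact: many_high_outdegree (is_tournament_converse hT) cA.
  - move=> S u w Sk uS wS; move: (good S); rewrite Sk => /forall_inP/(_ u uS).
    by move/forall_inP/(_ w wS).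
rewrite negb_forall => /existsP[S]; rewrite negb_imply => /andP[Sk].
rewrite negb_forall_in => /exists_inP[u /setDP[/setIdP[uA du] uS]].
rewrite negb_forall_in => /exists_inP[w /setDP[/setIdP[wA dw] wS]] nuw.
pose R := [set x in A :\: S | connect (e S) u x].
pose Q := [set x in A :\: S | ~~ connect (e S) u x].
have step x y : x \in A -> y \in A -> x \notin S -> y \notin S -> T x y ->
    connect (e S) x y.
  by move=> xA yA xS yS xy; apply: connect1;
     rewrite /e /induced /digraph_of /= !inE xS yS xy xA yA.
(* An arc from [r] to [q] would make [q] reachable from [u]. *)
have QR q r : q \in Q -> r \in R -> T q r.
  rewrite !inE => /andP[/andP[qS qA] nq] /andP[/andP[rS rA] cr].
  have : q != r by apply: contraNneq nq => ->.
  move/(hT.2 q r); case: (boolP (T r q)) => [rq|]; last by case: (T q r).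
  by rewrite (connect_trans cr (step _ _ rA qA rS qS rq)) in nq.
have big (B P : {set V}) : 2 * k <= #|B| -> B :\: S \subset P -> k <= #|P|.
  move=> cB /subset_leq_card; rewrite cardsD.
  have := subset_leq_card (subsetIr B S); lia.
(* Outside [S], the in-neighbours of [w] in [A] lie in [Q] and the out-neighbours of [u] in [A] lie
   in [R]; at least [2 * k - #|S|] of each remain. *)
exists Q, R; split.
- apply: big dw _; apply/subsetP => y; rewrite !inE => /and3P[yS yA yw].
  rewrite yS yA /=; apply: contra nuw => /connect_trans; apply.
  exact: step.
- apply: big du _; apply/subsetP => y; rewrite !inE => /and3P[yS yA uy].
  by rewrite yS yA /= step.
(* A single arc links [q] to [r], whatever else is deleted. *)
- move=> S' q r _ /setDP[qQ qS'] /setDP[rR rS'].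
  apply: connect1; rewrite /induced /digraph_of /= !inE qS' rS' (QR _ _ qQ rR).
  by move: qQ rR; rewrite !inE => /andP[/andP[_ ->] _] /andP[/andP[_ ->] _].
Qed.

(** * Assembling the subgraph *)

Lemma connect_induced_sub (V : finType) (E F : {set V * V}) (U : {set V}) x y :
  E \subset F -> connect (induced (digraph_of E) U) x y ->
  connect (induced (digraph_of F) U) x y.
Proof.
move=> EF; apply: connect_sub => a b /and3P[aU bU ab].
by apply: connect1; rewrite /induced /= aU bU; apply: (subsetP EF).
Qed.

Theorem theorem4p2 (k : nat) (V : finType) (T : rel V) :
  1 <= k -> is_tournament T -> strongly_k_connected T k ->
  exists D : rel V,
    [/\ spanning_subgraph D T, strongly_k_connected D k &
        #|arcs D| <= (5 * k - 2) * #|V| + 'C(5 * k, 2)].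
Proof.
(* With at most [5 * k] vertices, [T] itself fits in the binomial term. *)
move=> k0 hT sT; have [small|large] := leqP #|V| (5 * k).
  exists T; split=> //; apply: leq_trans (leq_addl _ _).
  have -> : arcs T = arcs T :&: setX setT setT.
    by apply/setP => p; rewrite !inE !andbT.
  by rewrite card_arcs_in_tournament // cardsT leq_bin2l.
have [A cA] : exists A : {set V}, #|A| = 5 * k.
  have : 5 * k <= #|[set: V]| by rewrite cardsT ltnW.
  by case/card_geqP=> s [us <- _]; exists [set x in s]; rewrite cardsE; apply/card_uniqP.
have cA5 : 5 * k <= #|A| by rewrite cA.
have [U [W [cU cW UW]]] := robust_pair k0 hT cA5.
have [F [sF cF hF]] := strong_corooted_certificate k0 cU sT.
have [G [sG cG hG]] := strong_rooted_certificate k0 cW sT.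
pose H := arcs T :&: setX A A; pose E := H :|: (F :|: G).
exists (digraph_of E); split.
- move=> x y; rewrite /digraph_of /= in_setU in_setU in_setI => /or3P[/andP[]||].
  + by rewrite inE.
  + by move/(subsetP sF); rewrite inE.
  + by move/(subsetP sG); rewrite inE.
- split; first by case: sT.
  move=> S Sk u v; rewrite !inE => uS vS.
  have {}Sk : #|S| < k by lia.
  have [a aU ua] := hF S u Sk uS; have [b bW bv] := hG S v Sk vS.
  (* The route runs from [u] to [a] in [U] by [F], on to [b] in [W] inside [A], then to [v] by
     [G]. *)
  apply: connect_trans (connect_trans (_ : connect _ a b) _).
  + by apply: connect_induced_sub ua; rewrite /E setUCA subsetUl.
  + by apply: connect_induced_sub (UW S a b Sk aU bW); rewrite subsetUl.
  + by apply: connect_induced_sub bv; rewrite /E setUA subsetUr.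
- have -> : arcs (digraph_of E) = E by apply/setP => -[x y]; rewrite inE.
  have cFG : #|F :|: G| <= (5 * k - 2) * #|V|.
    apply: leq_trans (leq_card_setU _ _) (leq_trans (leq_add cF cG) _).
    (* Here [k + k <= 5 * k - 2] because [k] is positive. *)
    by rewrite -mulnDl leq_mul2r; apply/orP; right; lia.
  rewrite addnC; apply: leq_trans (leq_card_setU _ _) (leq_add _ cFG).
  by rewrite card_arcs_in_tournament // cA.
Qed.
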